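(* Let $k$ be a field, $n\ge1$ an integer, $q=(q_{ij})$ a multiplicatively antisymmetric $n\times n$ matrix over $k^\times$, $L=k_q[[x_1^{\pm1},\ldots,x_n^{\pm1}]]$ the $q$-commutative Laurent series ring, and $Z$ the center of $L$. (i) Let $I$ be a (two-sided) ideal of $L$. Then $I=L(I\cap Z)$. (ii) Let $K$ be an ideal of $Z$. Then $K=(LK)\cap Z$.
   Context: Multiplicatively antisymmetric means $q_{ii}=1$ and $q_{ij}=q_{ji}^{-1}\in k^\times$ for all $i,j$. Let $R=k_q[[x_1,\ldots,x_n]]$ be the associative unital $k$-algebra of formal skew power series $\sum_{s\in\mathbb{N}^n} c_s x^s$ ($c_s\in k$, $x^s=x_1^{s_1}\cdots x_n^{s_n}$, $\mathbb{N}$ the non-negative integers), with multiplication determined by $x_ix_j=q_{ij}x_jx_i$. It is a noetherian domain and each $x_i$ is normal. The $q$-commutative Laurent series ring $L$ is the Ore localization of $R$ at the multiplicatively closed set generated by $1,x_1,\ldots,x_n$; its elements are the series $\sum_{s\in\mathbb{Z}^n}c_sx^s$, $c_s\in k$, with $c_s=0$ for $\min\{s_1,\ldots,s_n\}\ll0$. *)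

(* Defs.v *)
From HB Require Import structures.
From mathcomp Require Import all_boot all_order all_algebra.
From mathcomp Require Import finmap ring.
From mathcomp Require Import boolp classical_sets functions cardinality fsbigop.

Set Implicit Arguments.
Unset Strict Implicit.
Unset Printing Implicit Defensive.

Import Order.TTheory GRing.Theory Num.Theory.

Local Open Scope classical_set_scope.
Local Open Scope ring_scope.

(* q i j != 0 is not implied by the second equation: 0^-1 = 0 in a fieldType. *)
Definition multiplicatively_antisymmetric (k : fieldType) (n : nat)
    (q : 'M[k]_n) : Prop :=
  (forall i, q i i = 1) /\ (forall i j, q i j != 0 /\ q i j = (q j i)^-1).

(* The scalar such that x^s x^t = qweight q s t x^(s+t): moving x_j^(t_j) to  *)
(* the left past x_i^(s_i), for j < i, contributes q_ij^(s_i t_j).            *)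
Definition qweight (k : fieldType) (n : nat) (q : 'M[k]_n)
    (s t : 'rV[int]_n) : k :=
  \prod_(i < n) \prod_(j < n | (j < i)%N) q i j ^ (s 0 i * t 0 j).

(* Families (c_s) with c_s = 0 for min(s_1, ..., s_n) << 0.                   *)
Definition laurent_support (k : fieldType) (n : nat) :
    {pred 'rV[int]_n -> k} :=
  fun c => `[< exists N : int,
    forall s : 'rV[int]_n, (exists i, s 0 i < N) -> c s = 0 >].

(* The series \sum_s c_s x^s, encoded by their coefficients. The type depends *)
(* on the proof that q is multiplicatively antisymmetric because the product  *)
(* is associative only for such (or at least everywhere nonzero) q.           *)
Record laurent (k : fieldType) (n : nat) (q : 'M[k]_n)
    (hq : multiplicatively_antisymmetric q) : Type := Laurent {
  lcoef : 'rV[int]_n -> k;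
  lcoefP : lcoef \in @laurent_support k n }.

Section LaurentZmodule.
Variables (k : fieldType) (n : nat).

Lemma laurent_supportP (c : 'rV[int]_n -> k) :
  reflect (exists N : int, forall (s : 'rV[int]_n) i, s 0 i < N -> c s = 0)
          (c \in @laurent_support k n).
Proof.
apply: (iffP (asboolP _)) => -[N cN]; exists N.
  by move=> s i si; apply: cN; exists i.
by move=> s [i si]; apply: cN si.
Qed.

Lemma laurent_zmod_closed : zmod_closed (@laurent_support k n).
Proof.
split; first by apply/laurent_supportP; exists 0.
move=> c d /laurent_supportP[M cM] /laurent_supportP[N dN].
apply/laurent_supportP; exists (Num.min M N) => s i.
by rewrite lt_min => /andP[/cM cs /dN ds]; rewrite /= !fctE cs ds subr0.
Qed.

HB.instance Definition _ :=
  GRing.isZmodClosed.Build ('rV[int]_n -> k) (@laurent_support k n)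
    laurent_zmod_closed.

Variables (q : 'M[k]_n) (hq : multiplicatively_antisymmetric q).

HB.instance Definition _ := [isSub for @lcoef k n q hq].
HB.instance Definition _ := [Choice of laurent hq by <:].
HB.instance Definition _ := [SubChoice_isSubZmodule of laurent hq by <:].

End LaurentZmodule.

Section LaurentRing.
Variables (k : fieldType) (n : nat) (q : 'M[k]_n).
Hypothesis hq : multiplicatively_antisymmetric q.
Implicit Types (f g h : laurent hq) (s t u : 'rV[int]_n).

Let q_unit i j : q i j \is a GRing.unit.
Proof. by rewrite unitfE; case: (hq.2 i j). Qed.

Lemma laurentP f g : (forall s, lcoef f s = lcoef g s) -> f = g.
Proof. by move=> fg; apply/val_inj/funext. Qed.

Lemma qweightDl s s' t : qweight q (s + s') t = qweight q s t * qweight q s' t.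
Proof.
rewrite /qweight -big_split; apply: eq_bigr => i _ /=.
rewrite -big_split; apply: eq_bigr => j _ /=.
by rewrite mxE mulrDl exprzDr.
Qed.

Lemma qweightDr s t t' : qweight q s (t + t') = qweight q s t * qweight q s t'.
Proof.
rewrite /qweight -big_split; apply: eq_bigr => i _ /=.
rewrite -big_split; apply: eq_bigr => j _ /=.
by rewrite mxE mulrDr exprzDr.
Qed.

Lemma qweight0l t : qweight q 0 t = 1.
Proof.
by rewrite /qweight big1// => i _; rewrite big1// => j _; rewrite mxE mul0r.
Qed.

Lemma qweight0r s : qweight q s 0 = 1.
Proof.
by rewrite /qweight big1// => i _; rewrite big1// => j _; rewrite mxE mulr0.
Qed.

Lemma qweight_neq0 s t : qweight q s t != 0.
Proof.
apply/prodf_neq0 => i _; apply/prodf_neq0 => j _.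
by rewrite expfz_neq0// -unitfE.
Qed.

Definition mul_coef (c d : 'rV[int]_n -> k) (u : 'rV[int]_n) : k :=
  \sum_(s \in [set: 'rV[int]_n]) c s * d (u - s) * qweight q s (u - s).

Let box (a : int) (b : 'rV[int]_n) : set 'rV[int]_n :=
  [set s | forall i, a <= s 0 i <= b 0 i].

Let finite_box a b : finite_set (box a b).
Proof.
pose m := (\max_(i < n) absz (b 0 i - a)%R).+1.
pose e (w : {ffun 'I_n -> 'I_m}) : 'rV[int]_n := \row_i (a + (w i : nat)%:Z).
apply: (@sub_finite_set _ _ (e @` [set: {ffun 'I_n -> 'I_m}])); last first.
  exact/finite_image/finite_finset.
move=> s sB; exists [ffun i => inord (absz (s 0 i - a)%R)] => //.
apply/rowP => i; rewrite mxE ffunE; have /andP[as_ sb] := sB i.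
rewrite inordK; first by rewrite gez0_abs ?subr_ge0// addrC subrK.
rewrite ltnS; apply: leq_trans (leq_bigmax i).
by rewrite -lez_nat !gez0_abs ?subr_ge0 ?(le_trans as_ sb)// lerD2r.
Qed.

Let bounded N (c : 'rV[int]_n -> k) := forall s i, s 0 i < N -> c s = 0.

Let not_box a b s : ~ box a b s -> exists i, s 0 i < a \/ b 0 i < s 0 i.
Proof.
move=> /existsNP[i /negP]; rewrite negb_and -!ltNge => /orP[]; exists i; tauto.
Qed.

Let sum_box a b (F : 'rV[int]_n -> k) :
  (forall s, ~ box a b s -> F s = 0) ->
  \sum_(s \in [set: 'rV[int]_n]) F s = \sum_(s \in box a b) F s.
Proof. by move=> F0; apply/esym/fsbig_widen => // s [_ /F0]. Qed.

Let shift (a : int) u : 'rV[int]_n := \row_i (u 0 i - a).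

Let mul_coef_box a b c d u : bounded a c -> bounded b d ->
  mul_coef c d u =
  \sum_(s \in box a (shift b u)) c s * d (u - s) * qweight q s (u - s).
Proof.
move=> ca db; apply: sum_box => s /not_box[i []] si; first by rewrite (ca s i)// !mul0r.
rewrite (db _ i) ?mulr0 ?mul0r//.
by move: si; rewrite !mxE ltrBlDr ltrBlDl addrC.
Qed.

Let mul_coef_bounded a b c d : bounded a c -> bounded b d ->
  bounded (a + b) (mul_coef c d).
Proof.
move=> ca db u i ui; apply: fsbig1 => s _.
have [sa|sa] := ltP (s 0 i) a; first by rewrite (ca s i)// !mul0r.
rewrite (db _ i) ?mulr0 ?mul0r// !mxE ltrBlDr.
by apply: lt_le_trans ui _; rewrite addrC lerD2l.
Qed.

Lemma mul_coefP f g : mul_coef (lcoef f) (lcoef g) \in @laurent_support k n.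
Proof.
have /laurent_supportP[a fa] := lcoefP f.
have /laurent_supportP[b gb] := lcoefP g.
by apply/laurent_supportP; exists (a + b); apply: mul_coef_bounded.
Qed.

Definition laurent_mul f g : laurent hq := Laurent hq (mul_coefP f g).

Definition monom_coef (c : k) s : 'rV[int]_n -> k :=
  fun t => if t == s then c else 0.

Lemma monom_coefP c s : monom_coef c s \in @laurent_support k n.
Proof.
apply/laurent_supportP; exists (- (\max_(i < n) absz (s 0%R i))%N%:Z) => t i ti.
rewrite /monom_coef; case: eqP => // ts; move: ti; rewrite ts ltNge lerNl.
rewrite (le_trans (ler_norm _))// normrN.
by rewrite -abszE lez_nat (leq_bigmax i).
Qed.

(* The series c x^s. *)
Definition monom c s : laurent hq := Laurent hq (monom_coefP c s).

Lemma lcoef_monom_mul c s f u :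
  lcoef (laurent_mul (monom c s) f) u =
  c * lcoef f (u - s) * qweight q s (u - s).
Proof.
rewrite /= /mul_coef -(@fsbig_widen _ _ _ _ [set s])//; last first.
  by move=> t [_ /= /eqP/negPf ts]; rewrite /monom_coef ts !mul0r.
by rewrite fsbig_set1 /monom_coef eqxx.
Qed.

Lemma lcoef_mul_monom c s f u :
  lcoef (laurent_mul f (monom c s)) u =
  lcoef f (u - s) * c * qweight q (u - s) s.
Proof.
rewrite /= /mul_coef -(@fsbig_widen _ _ _ _ [set u - s])//; last first.
  move=> t [_ /= /eqP ts]; rewrite /monom_coef ifN ?mulr0 ?mul0r//.
  by apply: contraNN ts => /eqP <-; rewrite subKr.
by rewrite fsbig_set1 /monom_coef subKr eqxx.
Qed.

Lemma laurent_mulA : associative laurent_mul.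
Proof.
move=> f g h; apply: laurentP => u /=.
have /laurent_supportP[a fa] := lcoefP f.
have /laurent_supportP[b gb] := lcoefP g.
have /laurent_supportP[c hc] := lcoefP h.
set F := lcoef f; set G := lcoef g; set H := lcoef h.
rewrite (mul_coef_box _ fa (mul_coef_bounded gb hc)).
rewrite (mul_coef_box _ (mul_coef_bounded fa gb) hc).
pose S := box a (shift (b + c) u); pose T := box (a + b) (shift c u).
have -> : \sum_(t \in T) mul_coef F G t * H (u - t) * qweight q t (u - t) =
  \sum_(t \in T) \sum_(s \in S) F s * G (t - s) * qweight q s (t - s) *
    (H (u - t) * qweight q t (u - t)).
  apply: eq_fsbigr => t /set_mem tT; rewrite -mulrA -mulr_fsuml; congr (_ * _).
  apply: sum_box => s /not_box[i []] si; first by rewrite /F (fa s i)// !mul0r.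
  rewrite /G (gb _ i) ?mulr0 ?mul0r//; move: si; rewrite !mxE => si.
  have /andP[_] := tT i; rewrite !mxE => ti.
  rewrite ltrBlDr -ltrBlDl; apply: le_lt_trans si.
  by rewrite opprD addrA addrAC lerD2r.
rewrite exchange_fsbig; [|exact: finite_box|exact: finite_box].
apply: eq_fsbigr => s /set_mem sS.
rewrite -(@sum_box (a + b) (shift c u)); last first.
  move=> t /not_box[i []] ti; last first.
    rewrite /H (hc _ i) ?mulr0 ?mul0r ?mulr0//; move: ti.
    by rewrite !mxE ltrBlDr ltrBlDl addrC.
  rewrite /G (gb _ i) ?mulr0 ?mul0r// !mxE ltrBlDr.
  by apply: lt_le_trans ti _; rewrite addrC lerD2l; case/andP: (sS i).
rewrite (reindex_fsbigT (fun r => s + r)); last first.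
  by exists (fun r => r - s) => r; rewrite ?[s + r]addrC ?addrK// addrC subrK.
rewrite mulrAC mulr_fsumr; apply: eq_fsbigr => r _.
rewrite [s + r - s]addrAC subrr add0r opprD addrA.
have -> : qweight q s (u - s) = qweight q s r * qweight q s (u - s - r).
  by rewrite -qweightDr [r + _]addrC subrK.
rewrite qweightDl; rewrite /F /G /H; ring.
Qed.

Lemma laurent_mul1l : left_id (monom 1 0) laurent_mul.
Proof.
move=> f; apply: laurentP => u.
by rewrite lcoef_monom_mul subr0 mul1r qweight0l mulr1.
Qed.

Lemma laurent_mul1r : right_id (monom 1 0) laurent_mul.
Proof.
move=> f; apply: laurentP => u.
by rewrite lcoef_mul_monom subr0 mulr1 qweight0r mulr1.
Qed.

Lemma laurent_mulDl : left_distributive laurent_mul +%R.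
Proof.
move=> f g h; apply: laurentP => u.
have /laurent_supportP[a fa] := lcoefP f.
have /laurent_supportP[b gb] := lcoefP g.
have /laurent_supportP[c hc] := lcoefP h.
change (mul_coef (lcoef f + lcoef g) (lcoef h) u =
  mul_coef (lcoef f) (lcoef h) u + mul_coef (lcoef g) (lcoef h) u).
have fa' : bounded (Num.min a b) (lcoef f).
  by move=> s i; rewrite lt_min => /andP[/fa].
have gb' : bounded (Num.min a b) (lcoef g).
  by move=> s i; rewrite lt_min => /andP[_ /gb].
have fg : bounded (Num.min a b) (lcoef f + lcoef g).
  by move=> s i si; rewrite fctE (fa' s i)// (gb' s i)// addr0.
rewrite (mul_coef_box _ fg hc) (mul_coef_box _ fa' hc).
rewrite (mul_coef_box _ gb' hc) -fsbig_split; last exact: finite_box.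
by apply: eq_fsbigr => s _; rewrite fctE !mulrDl.
Qed.

Lemma laurent_mulDr : right_distributive laurent_mul +%R.
Proof.
move=> f g h; apply: laurentP => u.
have /laurent_supportP[a fa] := lcoefP f.
have /laurent_supportP[b gb] := lcoefP g.
have /laurent_supportP[c hc] := lcoefP h.
change (mul_coef (lcoef f) (lcoef g + lcoef h) u =
  mul_coef (lcoef f) (lcoef g) u + mul_coef (lcoef f) (lcoef h) u).
have gb' : bounded (Num.min b c) (lcoef g).
  by move=> s i; rewrite lt_min => /andP[/gb].
have hc' : bounded (Num.min b c) (lcoef h).
  by move=> s i; rewrite lt_min => /andP[_ /hc].
have gh : bounded (Num.min b c) (lcoef g + lcoef h).
  by move=> s i si; rewrite fctE (gb' s i)// (hc' s i)// addr0.
rewrite (mul_coef_box _ fa gh) (mul_coef_box _ fa gb').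
rewrite (mul_coef_box _ fa hc') -fsbig_split; last exact: finite_box.
by apply: eq_fsbigr => s _; rewrite fctE mulrDr !mulrDl.
Qed.

Lemma laurent_1neq0 : monom 1 0 != 0.
Proof.
apply/eqP => /(congr1 (fun f => lcoef f 0)) /=.
by rewrite /monom_coef eqxx; apply/eqP/oner_neq0.
Qed.

HB.instance Definition _ := GRing.Zmodule_isNzRing.Build (laurent hq)
  laurent_mulA laurent_mul1l laurent_mul1r laurent_mulDl laurent_mulDr
  laurent_1neq0.

Lemma lcoefM f g u :
  lcoef (f * g) u = \sum_(s \in [set: 'rV[int]_n])
    lcoef f s * lcoef g (u - s) * qweight q s (u - s).
Proof. by []. Qed.

End LaurentRing.

Section Generators.
Variables (k : fieldType) (n : nat) (q : 'M[k]_n).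
Hypothesis hq : multiplicatively_antisymmetric q.
Implicit Types (f g : laurent hq) (s t : 'rV[int]_n).

Local Notation L := (laurent hq).

Definition lvar (i : 'I_n) : L := monom hq 1 (delta_mx 0 i).

Lemma monomM c d s t :
  monom hq c s * monom hq d t = monom hq (c * d * qweight q s t) (s + t).
Proof.
apply: laurentP => u; rewrite lcoef_monom_mul /= /monom_coef subr_eq [t + s]addrC.
by case: eqP => [->|_]; rewrite ?mulr0 ?mul0r// [s + t]addrC addrK.
Qed.

Lemma qweight_delta (i j : 'I_n) :
  qweight q (delta_mx 0 i) (delta_mx 0 j) = if (j < i)%N then q i j else 1.
Proof.
rewrite /qweight (bigD1 i)//= [X in _ * X]big1 ?mulr1; last first.
  move=> a ai; rewrite big1// => b _; rewrite mxE eqxx (negPf ai) mul0r.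
  by rewrite expr0z.
case: ifPn => ji; last first.
  rewrite big1// => b bi; rewrite !mxE [b == j]negbTE ?mulr0 ?expr0z//.
  by apply: contraNneq ji => <-.
rewrite (bigD1 j)//= big1 ?mulr1 ?mxE ?eqxx ?mulr1 ?expr1z//.
by move=> b /andP[_ bj]; rewrite !mxE (negPf bj) andbF mulr0 expr0z.
Qed.

Lemma lvar_comm i j : lvar i * lvar j = monom hq (q i j) 0 * (lvar j * lvar i).
Proof.
rewrite !monomM add0r qweight0l !mulr1 !mul1r addrC !qweight_delta; congr monom.
have [ij|ji|/val_inj->] := ltngtP i j; first by rewrite (hq.2 i j).2 mulVf ?(hq.2 j i).1.
  by rewrite mulr1.
by rewrite hq.1 mulr1.
Qed.

Lemma lvarV i :
  lvar i * monom hq 1 (- delta_mx 0 i) = 1 /\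
  monom hq 1 (- delta_mx 0 i) * lvar i = 1.
Proof.
have e (a b : int) : qweight q (delta_mx 0 i *~ a) (delta_mx 0 i *~ b) = 1.
  rewrite /qweight big1// => a' _; rewrite big1// => b' ab.
  rewrite -!scaler_int !mxE !eqxx /=.
  have [ai|_] := eqVneq a' i; last by rewrite mulr0 mul0r expr0z.
  have [bi|_] := eqVneq b' i; last by rewrite !mulr0 expr0z.
  by move: ab; rewrite ai bi ltnn.
have /= := e 1 (-1); have /= := e (-1) 1; rewrite !mulrNz !mulr1z => e1 e2.
by rewrite !monomM e1 e2 !mulr1 subrr addNr.
Qed.

(* x^s is the ordered monomial x_1^(s_1) ... x_n^(s_n).                       *)
Lemma monom_prod (m : 'I_n -> nat) :
  monom hq 1 (\row_i (m i)%:Z) = \prod_(i < n) lvar i ^+ m i.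
Proof.
pose e (i : 'I_n) : 'rV[int]_n := delta_mx 0 i.
have lvarX i p : lvar i ^+ p = monom hq 1 (e i *+ p).
  elim: p => [|p IH]; first by rewrite expr0 mulr0n.
  rewrite exprS IH monomM !mul1r mulrS; congr monom.
  rewrite /qweight big1// => a _; rewrite big1// => b ba; rewrite mulmxnE !mxE !eqxx /=.
  have [ai|_] := eqVneq a i; last by rewrite mul0r expr0z.
  have [bi|_] := eqVneq b i; last by rewrite mul0rn mulr0 expr0z.
  by move: ba; rewrite ai bi ltnn.
have prodE (r : seq 'I_n) : sorted ltn (map val r) ->
    \prod_(i <- r) lvar i ^+ m i = monom hq 1 (\sum_(i <- r) e i *+ m i).
  elim: r => [|i r IH] /=; first by rewrite !big_nil.
  move=> ir; rewrite !big_cons IH ?(path_sorted ir)// lvarX monomM !mul1r.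
  congr monom; rewrite /qweight big1// => a _; rewrite big1// => b ba.
  rewrite mulmxnE mxE eqxx /=.
  have [ai|_] := eqVneq a i; last by rewrite mul0rn mul0r expr0z.
  rewrite summxE big_seq big1 ?mulr0 ?expr0z// => c cr.
  rewrite mulmxnE mxE eqxx /=; have [bc|_] := eqVneq b c; last by rewrite mul0rn.
  have /allP/(_ (val c)) := order_path_min ltn_trans ir.
  by rewrite map_f// => /(_ isT) /=; rewrite -bc -ai ltnNge ltnW.
rewrite prodE; last by rewrite [index_enum _]unlock -enumT val_enum_ord iota_ltn_sorted.
congr monom; apply/rowP => j; rewrite mxE summxE (bigD1 j)//= mulmxnE mxE !eqxx.
rewrite big1 ?addr0 ?natz// => i ij.
by rewrite mulmxnE mxE eqxx eq_sym (negPf ij) mul0rn.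
Qed.

(* The skew power series ring k_q[[x_1, ..., x_n]] as a subring of L.         *)
Definition power_series : set L :=
  [set f | forall s, (exists i, s 0 i < 0) -> lcoef f s = 0].

Lemma power_series_subring :
  [/\ power_series 1,
      forall f g, power_series f -> power_series g -> power_series (f - g) &
      forall f g, power_series f -> power_series g -> power_series (f * g)].
Proof.
split.
- move=> s [i si]; rewrite /= /monom_coef; case: eqP => // s0.
  by move: si; rewrite s0 mxE ltxx.
- by move=> f g fP gP s si; rewrite [LHS]/= -[LHS]/(lcoef f s - lcoef g s) fP// gP// subrr.
- move=> f g fP gP s [i si]; rewrite lcoefM; apply: fsbig1 => t _.
  have [ti|ti] := ltP (t 0 i) 0; first by rewrite fP ?mul0r//; exists i.
  rewrite gP ?mulr0 ?mul0r//; exists i; rewrite !mxE subr_lt0.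
  exact: lt_le_trans si ti.
Qed.

(* L is the localization of power_series at the monomials: by lvarV the       *)
(* variables are invertible in L, and every series has a left denominator.    *)
Lemma laurent_denominator f :
  exists m : nat, power_series (monom hq 1 (const_mx m%:Z) * f).
Proof.
have /laurent_supportP[N fN] := lcoefP f.
exists `|N|%N => s [i si]; rewrite lcoef_monom_mul (fN _ i) ?mulr0 ?mul0r//.
rewrite !mxE ltrBlDr (lt_le_trans si)// -lerBlDl sub0r abszE.
by rewrite -normrN ler_norm.
Qed.

End Generators.

Definition ring_center (R : pzRingType) : set R :=
  [set z | forall a, GRing.comm z a].
Arguments ring_center R : clear implicits.

(* Two-sided ideals of the subring S of R; the ideals of R itself are those   *)
(* of S = setT.                                                               *)
Definition is_ideal_of (R : pzRingType) (S I : set R) : Prop :=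
  [/\ I `<=` S, I 0, forall x y, I x -> I y -> I (x - y) &
      forall a x, S a -> I x -> I (a * x) /\ I (x * a)].

(* R A, the set of finite sums of products a z with a in R and z in A.        *)
Definition left_span (R : pzRingType) (A : set R) : set R :=
  [set f | exists m (a z : 'I_m -> R),
    (forall i, A (z i)) /\ f = \sum_(i < m) a i * z i].

(* Main.v *)
(* The heart of the matter is that every left ideal of L is closed, among     *)
(* power series, for coefficientwise convergence. Order the exponents         *)
(* degree-lexicographically. By Dickson's lemma the leading exponents of the  *)
(* power series in the ideal are generated by those of finitely many g_e, and *)
(* a power series can be reduced modulo the g_e, with power series as         *)
(* quotients, until no such exponent is left in its support; the remainder of *)
(* a limit point of the ideal is then 0.                                      *)
(* Conjugation by monomials acts diagonally on the coefficients, so a weight  *)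
(* component of f in I is a coefficientwise limit of elements of I, hence in  *)
(* I, and it is a monomial times an element of the center. In turn f is the   *)
(* limit of finite sums of its weight components, hence in L(I & Z). For      *)
(* (ii), the restriction to the central exponents is a Z-linear retraction of *)
(* L onto Z.                                                                  *)
Require Import Defs.
From mathcomp Require Import all_boot all_order all_algebra.
From mathcomp Require Import ring.
From mathcomp Require Import boolp classical_sets functions fsbigop.

Set Implicit Arguments.
Unset Strict Implicit.
Unset Printing Implicit Defensive.

Import Order.TTheory GRing.Theory Num.Theory.

Local Open Scope classical_set_scope.
Local Open Scope ring_scope.

(** Conjugation by [x^t] multiplies [x^s] by the scalar [weight t s], a character in [s]. The center
    consists of the series supported on the common kernel of these characters ([centerP]), and a
    series supported on one coset of this kernel is a monomial times a central element. Combining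
    conjugates of an element of an ideal isolates one coset on any prescribed finite set of
    exponents ([separate_weights]). A series may meet infinitely many cosets, so (i) takes limits
    twice: to place each weight component in the ideal, and to recover the series from its
    components. Both limits come from [left_ideal_closed], which rests on division by a finite
    standard basis ([dickson], [combination_surj]); a monomial unit reduces the claim to power
    series. For (ii), the retraction [restrict central_exponent] makes the coefficients of a sum of
    products central ([left_span_center]). *)

Section Deglex.
Variable n : nat.
Implicit Types u v w : 'rV[int]_n.

(** * Degree-lexicographic order and Dickson's lemma *)

Definition nonneg u := forall i, 0 <= u 0 i.

Definition deg u : int := \sum_i u 0 i.

Definition deglex u v : Prop := deg u < deg v \/ deg u = deg v /\
  exists i, u 0 i < v 0 i /\ forall j : 'I_n, (j < i)%N -> u 0 j = v 0 j.

Lemma degD u v : deg (u + v) = deg u + deg v.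
Proof. by rewrite -big_split; apply: eq_bigr => i _; rewrite mxE. Qed.

Lemma deglex_irr u : ~ deglex u u.
Proof. by case=> [|[_ [i []]]]; rewrite ltxx. Qed.

Lemma deglex_trans v u w : deglex u v -> deglex v w -> deglex u w.
Proof.
case=> [uv|[uv [i [uvi uvj]]]] [vw|[vw [j [vwj vwi]]]].
- by left; apply: lt_trans vw.
- by left; rewrite -vw.
- by left; rewrite uv.
right; split; first by rewrite uv.
have [ij|ji|/val_inj ij] := ltngtP i j.
- exists i; rewrite -vwi//; split=> // l li.
  by rewrite uvj// vwi// (ltn_trans li).
- exists j; rewrite uvj//; split=> // l lj.
  by rewrite uvj ?vwi// (ltn_trans lj).
- subst j; exists i; split; first exact: lt_trans vwj.
  by move=> l li; rewrite uvj ?vwi.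
Qed.

Lemma deglex_total u v : [\/ u = v, deglex u v | deglex v u].
Proof.
have [uv|uv|duv] := ltgtP (deg u) (deg v).
- by apply: Or32; left.
- by apply: Or33; left.
have [->|uv] := eqVneq u v; first exact: Or31.
have /existsP[i0 i0P] : [exists i, u 0 i != v 0 i].
  apply: contraNT uv; rewrite negb_exists => /forallP uv.
  by apply/eqP/rowP => i; apply/eqP/negPn/uv.
case: (arg_minnP (P := fun i => u 0 i != v 0 i) val i0P) => i /eqP uvi min_i.
have uvj (j : 'I_n) : (j < i)%N -> u 0 j = v 0 j.
  by move=> ji; apply: contraTeq ji => /min_i; rewrite -leqNgt.
have [ui|vi|//] := ltgtP (u 0 i) (v 0 i).
- by apply: Or32; right; split=> //; exists i.
- by apply: Or33; right; split=> //; exists i; split=> // j /uvj.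
Qed.

Lemma deglexD2r w u v : deglex u v -> deglex (u + w) (v + w).
Proof.
rewrite /deglex !degD ltrD2r => -[|[-> [i [uvi uvj]]]]; [by left|right].
split=> //; exists i; rewrite !mxE ltrD2r; split=> // j /uvj.
by rewrite !mxE => ->.
Qed.

Lemma deglex_finite u :
  exists V : seq 'rV[int]_n, forall v, nonneg v -> deglex v u -> v \in V.
Proof.
pose d := absz (deg u).
exists [seq \row_i (w i : nat)%:Z | w : {ffun 'I_n -> 'I_d.+1}] => v v0 vu.
have vd i : v 0 i <= d.
  apply: le_trans (_ : deg v <= _).
    by rewrite /deg (bigD1 i)//= lerDl sumr_ge0.
  apply: le_trans (_ : deg u <= _); last by rewrite /d abszE ler_norm.
  by case: vu => [/ltW|[->]].
apply/mapP; exists [ffun i => inord (absz (v 0 i))]; first by rewrite mem_enum.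
apply/rowP => i; rewrite mxE ffunE inordK ?gez0_abs//.
by rewrite ltnS -lez_nat gez0_abs.
Qed.

(** Induction on the number of members of a finite list [V] that lie below the exponent: [V] still
    serves for a smaller [v], and [v] itself is no longer counted. *)
Lemma deglex_wf : well_founded (fun v u => nonneg v /\ deglex v u).
Proof.
move=> u; have [V uV] := deglex_finite u.
pose c v := count (fun w => `[< deglex w v >]) V.
have [m] := ubnP (c u).
elim: m u uV => [u _|m IH u uV cu]; first by rewrite ltn0.
constructor=> v [v0 vu]; apply: IH => [w w0 wv|].
  by apply: uV => //; apply: deglex_trans vu.
rewrite ltnS in cu; apply: leq_trans cu.
rewrite /c -[leqRHS]size_filter.
have -> : count (fun w => `[< deglex w v >]) V =
    count (fun w => `[< deglex w v >]) [seq w <- V | `[< deglex w u >]].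
  rewrite count_filter; apply: eq_count => w /=.
  apply/asboolP/andP => [wv|[/asboolP//]]; split; apply/asboolP => //.
  exact: deglex_trans vu.
rewrite ltn_neqAle count_size andbT -all_count; apply/negP => /allP/(_ v).
rewrite mem_filter uV//= andbT => /(_ (asboolT vu)) /asboolP.
exact: deglex_irr.
Qed.

(** Induction on the coordinates compared. If [G] settles those in [r] and [M] is its largest [i]-th
    entry, then [G] also settles every [u] with [M <= u 0 i]; the other [u] lie in finitely many
    slices with fixed [i]-th entry. *)
Lemma dickson (E : set 'rV[int]_n) : E `<=` nonneg ->
  exists2 G : seq 'rV[int]_n, (forall e, e \in G -> E e) &
    forall u, E u -> exists2 e, e \in G & forall i, e 0 i <= u 0 i.
Proof.
suff H (r : seq 'I_n) : forall E : set 'rV[int]_n, E `<=` nonneg ->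
    exists2 G : seq 'rV[int]_n, (forall e, e \in G -> E e) &
    forall u, E u -> exists2 e, e \in G & forall i, i \in r -> e 0 i <= u 0 i.
  move=> /(H (enum 'I_n))[G GE EG]; exists G => // u /EG[e eG eu].
  by exists e => // i; apply: eu; rewrite mem_enum.
elim: r => [|i r IH] {}E E0.
  have [[e Ee]|nE] := pselect (exists e, E e).
    exists [:: e] => [e'|u _]; first by rewrite inE => /eqP->.
    by exists e; rewrite ?inE.
  by exists [::] => // u Eu; case: nE; exists u.
have [G GE EG] := IH E E0.
have /choice[H HP] (m : nat) : exists G : seq 'rV[int]_n,
    (forall e, e \in G -> E e /\ e 0 i = m) /\
    forall u, E u -> u 0 i = m ->
      exists2 e, e \in G & forall j, j \in r -> e 0 j <= u 0 j.
  have [|G' G'E EG'] := IH [set u | E u /\ u 0 i = m]; first by move=> u [/E0].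
  by exists G'; split=> // u Eu um; apply: EG'.
pose M := \max_(e <- G) absz ((e : 'rV[int]_n) 0%R i).
exists (G ++ flatten [seq H m | m <- iota 0 M]) => [e|u Eu].
  rewrite mem_cat => /orP[/GE//|/flatten_mapP[m _ /(HP m).1[]//]].
have [um|Mu] := ltnP (absz (u 0 i)) M.
  have ui : u 0 i = absz (u 0 i) by rewrite gez0_abs ?E0.
  have [e eH eu] := (HP _).2 u Eu ui.
  exists e; first rewrite mem_cat; first apply/orP; first right.
    by apply/flatten_mapP; exists (absz (u 0 i)) => //; rewrite mem_iota.
  by move=> j; rewrite inE => /predU1P[->|/eu//]; rewrite ((HP _).1 e eH).2 -ui.
have [e eG eu] := EG u Eu; exists e; first by rewrite mem_cat eG.
move=> j; rewrite inE => /predU1P[->|/eu//].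
have e0 : 0 <= e 0 i by apply/E0/GE.
have u0 : 0 <= u 0 i by apply: E0.
rewrite -(gez0_abs e0) -(gez0_abs u0) lez_nat.
by apply: leq_trans Mu; apply: leq_bigmax_seq.
Qed.

End Deglex.

(** Well-founded recursion; values at non-predecessors are replaced by 0, which [F] cannot see. *)
Lemma wf_fixpoint (X : Type) (k : zmodType) (r : X -> X -> Prop)
    (F : (X -> k) -> X -> k) : well_founded r ->
  (forall c d u, (forall v, r v u -> c v = d v) -> F c u = F d u) ->
  exists c, forall u, c u = F c u.
Proof.
move=> wf Fr.
pose G u (rec : forall v, r v u -> k) :=
  F (fun v => if pselect (r v u) is left vu then rec v vu else 0) u.
exists (Fix wf _ G) => u; rewrite Fix_eq => [|v a b ab].
  by apply: Fr => v vu; case: pselect.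
by apply: Fr => w wv; case: pselect.
Qed.

Lemma sub_closedD (V : zmodType) (A : set V) : A 0 ->
  (forall x y, A x -> A y -> A (x - y)) ->
  forall x y, A x -> A y -> A (x + y).
Proof.
by move=> A0 AB x y Ax Ay; rewrite -[y]opprK -[- y]sub0r; apply/(AB)/AB.
Qed.

(** * Standard bases and closedness of left ideals *)

Section StandardBasis.
Variables (k : fieldType) (n : nat) (q : 'M[k]_n).
Hypothesis hq : multiplicatively_antisymmetric q.
Local Notation L := (laurent hq).
Implicit Types (f g a : L) (u v w e : 'rV[int]_n).

Lemma lcoefD f g u : lcoef (f + g) u = lcoef f u + lcoef g u.
Proof. by []. Qed.

Lemma lcoefB f g u : lcoef (f - g) u = lcoef f u - lcoef g u.
Proof. by []. Qed.

Lemma lcoef_sum (I : Type) (r : seq I) (F : I -> L) u :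
  lcoef (\sum_(i <- r) F i) u = \sum_(i <- r) lcoef (F i) u.
Proof. by elim/big_rec2: _ => // i x y _ <-. Qed.

Lemma power_series0 f u : power_series f -> ~ nonneg u -> lcoef f u = 0.
Proof.
by move=> fR /existsNP[i /negP]; rewrite -ltNge => ui; apply: fR; exists i.
Qed.

Definition lead f u := lcoef f u != 0 /\ forall v, deglex v u -> lcoef f v = 0.

Lemma lead_exists f : power_series f -> f <> 0 ->
  exists2 u, nonneg u & lead f u.
Proof.
move=> fR f0; apply: contrapT => nlead; apply: f0; apply: laurentP => u.
elim/(well_founded_ind (@deglex_wf n)): u => u IH; apply: contrapT => fu.
have u0 : nonneg u by apply: contrapT => /(power_series0 fR).
apply: nlead; exists u => //; split=> [|v vu]; first exact/eqP.
by have [v0|/(power_series0 fR)//] := pselect (nonneg v); apply: IH.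
Qed.

Section Division.
Variables (E : set 'rV[int]_n) (G : seq 'rV[int]_n).
Variable sel : 'rV[int]_n -> 'rV[int]_n.
Variable g : 'rV[int]_n -> L.
Hypothesis E_nonneg : E `<=` @nonneg n.
Hypothesis selG : forall u, E u -> sel u \in G.
Hypothesis sel_le : forall u, E u -> forall i, sel u 0 i <= u 0 i.
Hypothesis g_lead : forall e, e \in G -> lead (g e) e.
Implicit Types c d : 'rV[int]_n -> k.

(** Each [u] in [E] is charged to the single divisor [g (sel u)]: [c u] is the coefficient of
    [x^(u - sel u)] in its quotient. *)
Definition quotient_coef c e w : k :=
  if `[< E (w + e) >] && (sel (w + e) == e) then c (w + e) else 0.

Lemma quotient_coef_nonneg c e w : (exists i, w 0 i < 0) ->
  quotient_coef c e w = 0.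
Proof.
case=> i wi; rewrite /quotient_coef; case: ifP => // /andP[/asboolP Ew /eqP se].
by have := sel_le Ew i; rewrite se mxE lerDr leNgt wi.
Qed.

Lemma quotient_coefP c e : quotient_coef c e \in @laurent_support k n.
Proof.
apply/laurent_supportP; exists 0 => w i wi.
by apply: quotient_coef_nonneg; exists i.
Qed.

Definition quotient c e : L := Laurent hq (quotient_coefP c e).

Definition combination c : L := \sum_(e <- undup G) quotient c e * g e.

Lemma combinationD c d :
  combination (fun u => c u + d u) = combination c + combination d.
Proof.
rewrite /combination -big_split; apply: eq_bigr => e _ /=.
rewrite -mulrDl; congr (_ * _); apply: laurentP => w.
by rewrite lcoefD /= /quotient_coef; case: ifP => // _; rewrite addr0.
Qed.

Definition pivot u : k :=
  lcoef (g (sel u)) (sel u) * qweight q (u - sel u) (sel u).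

Lemma pivot_neq0 u : E u -> pivot u != 0.
Proof. by move=> /selG/g_lead[g0 _]; rewrite mulf_neq0 ?qweight_neq0. Qed.

Lemma lcoef_combination c u : E u ->
  (forall v, E v -> deglex v u -> c v = 0) ->
  lcoef (combination c) u = c u * pivot u.
Proof.
move=> Eu c0; rewrite lcoef_sum.
have term e : e \in G -> lcoef (quotient c e * g e) u =
    if sel u == e then c u * pivot u else 0.
  (* For [w] other than [u - e], either [w + e] is below [u] and the quotient coefficient vanishes,
     or [u - w] is below the leading exponent [e] of [g e]. *)
  move=> eG; rewrite lcoefM -(@fsbig_widen _ _ _ _ [set u - e])//; last first.
    move=> w [_ /= we]; rewrite /quotient_coef.
    case: ifP => [/andP[/asboolP Ewe _]|_]; last by rewrite !mul0r.
    have [weu|weu|weu] := deglex_total (w + e) u.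
    - by case: we; rewrite -weu addrK.
    - by rewrite c0// !mul0r.
    rewrite (g_lead eG).2 ?mulr0 ?mul0r//.
    by have := deglexD2r (- w) weu; rewrite [w + e]addrC addrK.
  rewrite fsbig_set1 /= /quotient_coef subrK asboolT//=.
  by rewrite subKr /pivot; case: eqP => [->|_]; rewrite ?mulrA ?mul0r.
rewrite (eq_big_seq (fun e => if sel u == e then c u * pivot u else 0)).
  rewrite (bigD1_seq (sel u)) ?undup_uniq ?mem_undup ?selG//= eqxx.
  by rewrite big1 ?addr0// => e; rewrite eq_sym => /negPf->.
by move=> e; rewrite mem_undup => /term.
Qed.

(* The coefficient at u of a combination involves only the values of c at     *)
(* v <= u, with the invertible factor [pivot u] at v = u.                     *)
Lemma combination_surj f :
  exists c, forall u, E u -> lcoef (combination c) u = lcoef f u.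
Proof.
pose trunc c u v := if `[< nonneg v /\ deglex v u >] then c v else 0.
pose F c u := (lcoef f u - lcoef (combination (trunc c u)) u) / pivot u.
have [c d u cd|c cF] := wf_fixpoint (F := F) (@deglex_wf n).
  rewrite /F; have -> // : trunc c u = trunc d u.
  by apply/funext => v; rewrite /trunc; case: asboolP => // /cd.
exists c => u Eu.
(* [d] vanishes on [E] below [u], so [lcoef_combination] gives its contribution at [u]. *)
pose d v := c v - trunc c u v.
have -> : c = fun v => trunc c u v + d v.
  by apply/funext => v; rewrite addrC subrK.
rewrite combinationD lcoefD (@lcoef_combination d)//.
  rewrite {}/d {2}/trunc asboolF; last by case=> _ /deglex_irr.
  by rewrite subr0 cF /F divfK ?pivot_neq0// addrC subrK.
move=> v Ev vu; rewrite /d /trunc asboolT ?subrr//.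
by split=> //; apply: E_nonneg.
Qed.

End Division.

Lemma left_ideal_closed (A : set L) f : A 0 ->
  (forall x y, A x -> A y -> A (x + y)) -> (forall a x, A x -> A (a * x)) ->
  power_series f ->
  (forall V : seq 'rV[int]_n, exists2 a, A a /\ power_series a &
     forall v, v \in V -> lcoef a v = lcoef f v) ->
  A f.
Proof.
move=> A0 AD AM fR fA.
have AB x y : A x -> A y -> A (x - y).
  by move=> Ax Ay; apply: AD => //; rewrite -mulN1r; apply: AM.
pose R : set L := @power_series k n q hq.
have [R1 RB RM] := power_series_subring hq.
have R0 : R 0 by rewrite -(subrr 1); apply: RB.
have RD := sub_closedD R0 RB.
pose E : set 'rV[int]_n :=
  [set u | nonneg u /\ exists2 a, A a /\ R a & lead a u].
have E_nonneg : E `<=` @nonneg n by move=> u [].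
have [G GE EG] := dickson E_nonneg.
have /choice[g gP] e : exists a, E e -> [/\ A a, R a & lead a e].
  have [[_ [a [Aa Ra] ae]]|nE] := pselect (E e); first by exists a.
  by exists 0.
have /choice[sel selP] u : exists e, E u ->
    e \in G /\ forall i, e 0 i <= u 0 i.
  have [/EG[e eG eu]|nE] := pselect (E u); first by exists e.
  by exists 0.
have sel_le u : E u -> forall i, sel u 0 i <= u 0 i by move=> /selP[].
have selG u : E u -> sel u \in G by move=> /selP[].
have g_lead e : e \in G -> lead (g e) e by move=> /GE/gP[].
have [c cE] := combination_surj E_nonneg selG sel_le g_lead f.
set h := combination _ _ _ c in cE.
have [Ah Rh] : A h /\ R h.
  rewrite /h /combination big_seq.
  elim/big_rec: _ => // e x; rewrite mem_undup => /GE/gP[Age Rge _] [Ax Rx].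
  split; first by apply: AD => //; apply: AM.
  apply: RD => //; apply: RM => // s si.
  exact: quotient_coef_nonneg.
suff -> : f = h by [].
apply: contrapT => fh.
have [/subr0_eq//|u u0 fhu] := lead_exists (RB _ _ fR Rh).
have [V uV] := deglex_finite u.
have [a [Aa Ra] aV] := fA (u :: V).
(* [a] agrees with [f] up to [u], so [a - h] has the leading exponent [u] of [f - h]. Hence [u] is
   in [E], where [f] and [h] agree: a contradiction. *)
have Eu : E u.
  split=> //; exists (a - h); first by split; [exact: AB|exact: RB].
  have [fhu0 fhv0] := fhu; split.
    by rewrite lcoefB aV ?mem_head// -lcoefB.
  move=> v vu; have [v0|/power_series0] := pselect (nonneg v); last first.
    by apply; apply: RB.
  by rewrite lcoefB aV ?inE ?uV ?orbT// -lcoefB fhv0.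
by have [] := fhu; rewrite lcoefB cE// subrr eqxx.
Qed.

End StandardBasis.

(** * Left ideals generated by a set *)

Section LeftSpan.
Variables (R : pzRingType) (A : set R).

Lemma left_span_sub : A `<=` left_span A.
Proof.
by move=> z Az; exists 1%N, (fun=> 1), (fun=> z); rewrite big_ord1 mul1r.
Qed.

Lemma left_span0 : left_span A 0.
Proof.
by exists 0%N, (fun=> 0), (fun=> 0); rewrite big_ord0; split=> // -[].
Qed.

Lemma left_spanD x y : left_span A x -> left_span A y -> left_span A (x + y).
Proof.
move=> [m [a [z [Az ->]]]] [p [b [t [At ->]]]].
exists (m + p)%N.
exists (fun i => match fintype.split i with inl j => a j | inr j => b j end).
exists (fun i => match fintype.split i with inl j => z j | inr j => t j end).
split=> [i|]; first by case: fintype.split.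
rewrite big_split_ord; congr (_ + _); apply: eq_bigr => i _.
  by rewrite (unsplitK (inl i)).
by rewrite (unsplitK (inr i)).
Qed.

Lemma left_spanM r x : left_span A x -> left_span A (r * x).
Proof.
move=> [m [a [z [Az ->]]]]; exists m, (fun i => r * a i), z; split=> //.
by rewrite mulr_sumr; apply: eq_bigr => i _; rewrite mulrA.
Qed.

End LeftSpan.

(** * Weights and the center *)

Section Center.
Variables (k : fieldType) (n : nat) (q : 'M[k]_n).
Hypothesis hq : multiplicatively_antisymmetric q.
Local Notation L := (laurent hq).
Local Notation Z := (ring_center L).
Implicit Types (f g a z : L) (s t u v w : 'rV[int]_n) (P : set 'rV[int]_n).

Lemma qweightNl s t : qweight q (- s) t = (qweight q s t)^-1.
Proof.
apply: (mulIf (qweight_neq0 hq s t)); rewrite mulVf ?qweight_neq0//.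
by rewrite -(qweightDl hq) addNr qweight0l.
Qed.

Lemma qweightNr s t : qweight q s (- t) = (qweight q s t)^-1.
Proof.
apply: (mulIf (qweight_neq0 hq s t)); rewrite mulVf ?qweight_neq0//.
by rewrite -(qweightDr hq) addNr qweight0r.
Qed.

(* x^t x^s (x^t)^-1 = weight t s * x^s *)
Definition weight t s : k := qweight q t s / qweight q s t.

Lemma weight_neq0 t s : weight t s != 0.
Proof. by rewrite mulf_neq0 ?invr_neq0 ?qweight_neq0. Qed.

Lemma weightD t s s' : weight t (s + s') = weight t s * weight t s'.
Proof. by rewrite /weight (qweightDr hq) (qweightDl hq) invfM; ring. Qed.

Lemma weightN t s : weight t (- s) = (weight t s)^-1.
Proof. by rewrite /weight qweightNr qweightNl invfM. Qed.

Lemma weightB t s s' : weight t (s - s') = weight t s / weight t s'.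
Proof. by rewrite weightD weightN. Qed.

(* (x^t)^-1 = qweight q t t * x^(-t) *)
Definition conj t f : L :=
  monom hq 1 t * f * monom hq (qweight q t t) (- t).

Lemma lcoef_conj t f u : lcoef (conj t f) u = weight t u * lcoef f u.
Proof.
rewrite /conj lcoef_mul_monom lcoef_monom_mul opprK addrK mul1r.
rewrite (qweightDl hq) !qweightNr /weight.
have := qweight_neq0 hq t t; have := qweight_neq0 hq u t.
by move=> ut tt; field; rewrite ut tt.
Qed.

Definition same_weight u v := forall t, weight t u = weight t v.

Definition central_exponent : set 'rV[int]_n := same_weight^~ 0.

Lemma weight0 t : weight t 0 = 1.
Proof. by rewrite /weight qweight0r qweight0l divr1. Qed.

Lemma same_weight_sub u v : same_weight u v <-> central_exponent (u - v).
Proof.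
split=> uv t; first by rewrite weightB uv divff ?weight_neq0 ?weight0.
by have := uv t; rewrite weightB weight0 => /divr1_eq.
Qed.

(** Commuting with every [x^t] forces weight 1 on the support. Conversely, the substitution of
    [u - s] for [s] matches the two products term by term. *)
Lemma centerP z :
  Z z <-> forall u, ~ central_exponent u -> lcoef z u = 0.
Proof.
split=> [Zz u nu|z0 f].
  apply: contrapT => /eqP zu; apply: nu => t; rewrite weight0.
  have /(congr1 (fun h => lcoef h (t + u))) := Zz (monom hq 1 t).
  rewrite lcoef_monom_mul lcoef_mul_monom [t + u]addrC addrK.
  rewrite mulr1 mul1r => /(mulfI zu) ut.
  by rewrite /weight ut divff ?qweight_neq0.
apply: laurentP => u; rewrite !lcoefM.
rewrite (reindex_fsbigT (fun s => u - s)); last first.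
  by exists (fun s => u - s) => s; rewrite subKr.
apply: eq_fsbigr => s _; rewrite subKr.
have [su|/z0->] := pselect (central_exponent (u - s)); last first.
  by rewrite mulr0 !mul0r.
have := su s; rewrite weight0 /weight => /divr1_eq->.
by rewrite [lcoef f s * _]mulrC.
Qed.

Lemma restrict_subproof P f :
  (fun u => if `[< P u >] then lcoef f u else 0) \in @laurent_support k n.
Proof.
have /laurent_supportP[N fN] := lcoefP f.
by apply/laurent_supportP; exists N => s i /fN->; rewrite if_same.
Qed.

Definition restrict P f : L := Laurent hq (restrict_subproof P f).

(** The central exponents form a subgroup, so multiplication by a series supported on them does not
    mix them with other exponents. *)
Lemma restrictM_center f z : Z z ->
  restrict central_exponent (f * z) = restrict central_exponent f * z.
Proof.
move=> /centerP Zz; apply: laurentP => u; rewrite /= /mul_coef.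
have S_D s t : central_exponent s -> central_exponent t ->
    central_exponent (s + t).
  by move=> Ss St r; rewrite weightD Ss St weight0 mulr1.
have S_N s : central_exponent s -> central_exponent (- s).
  by move=> Ss r; rewrite weightN Ss weight0 invr1.
case: asboolP => Su.
  apply: eq_fsbigr => s _.
  have [Sus|/Zz->] := pselect (central_exponent (u - s)); last first.
    by rewrite !mulr0 !mul0r.
  by rewrite asboolT// -(subKr u s); apply/S_D/S_N.
apply/esym/fsbig1 => s _; case: asboolP => Ss; last by rewrite !mul0r.
rewrite Zz ?mulr0 ?mul0r// => Sus; apply: Su.
by rewrite -(subrK s u); apply: S_D.
Qed.

Lemma restrict_center z : Z z -> restrict central_exponent z = z.
Proof.
move=> /centerP Zz; apply: laurentP => u /=.
by case: asboolP => // /Zz.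
Qed.

Lemma restrict_power_series P f : power_series f -> power_series (restrict P f).
Proof. by move=> fR s si /=; rewrite fR ?if_same. Qed.

(** * Generation of ideals by central elements *)

Section Ideal.
Variables (I : set L).
Hypothesis idealI : is_ideal_of setT I.

Let I0 : I 0. Proof. by case: idealI. Qed.

Let IB x y : I x -> I y -> I (x - y).
Proof. by case: idealI => _ _ + _; apply. Qed.

Let IMl a x : I x -> I (a * x).
Proof. by case: idealI => _ _ _ /(_ a x Logic.I) H /H[]. Qed.

Let IMr a x : I x -> I (x * a).
Proof. by case: idealI => _ _ _ /(_ a x Logic.I) H /H[]. Qed.

Let ID x y : I x -> I y -> I (x + y).
Proof. exact: sub_closedD. Qed.

(* If t separates the weights of v and u, then (conj t - weight t v) divided  *)
(* by (weight t u - weight t v) kills x^v and fixes every x^w in the weight   *)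
(* space of x^u.                                                              *)
Lemma separate_weights f u (V : seq 'rV[int]_n) : I f -> exists h,
  [/\ I h, forall w, same_weight w u -> lcoef h w = lcoef f w,
      forall w, w \in V -> ~ same_weight w u -> lcoef h w = 0 &
      forall w, lcoef f w = 0 -> lcoef h w = 0].
Proof.
move=> If; elim: V => [|v V [h [Ih hf hV h0]]]; first by exists f.
have [vu|/existsNP[t /eqP tvu]] := pselect (same_weight v u).
  exists h; split=> // w; rewrite inE => /predU1P[->//|]; exact: hV.
have d0 : weight t u - weight t v != 0 by rewrite subr_eq0 eq_sym.
pose c := (weight t u - weight t v)^-1.
exists (monom hq c 0 * (conj t h - monom hq (weight t v) 0 * h)).
have hE w : lcoef (monom hq c 0 * (conj t h - monom hq (weight t v) 0 * h)) w =
    c * (weight t w - weight t v) * lcoef h w.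
  rewrite lcoef_monom_mul lcoefB lcoef_conj lcoef_monom_mul !subr0 !qweight0l.
  ring.
split=> [|w wu|w|w /h0]; rewrite ?hE.
- by apply/IMl/IB; [apply/IMr/IMl|apply: IMl].
- by rewrite wu mulVf// mul1r hf.
- rewrite inE => /predU1P[->|wV wu]; first by rewrite subrr mulr0 mul0r.
  by rewrite (hV w wV wu) mulr0.
- by move->; rewrite mulr0.
Qed.

Lemma ideal_weight_component f u : power_series f -> I f ->
  I (restrict (same_weight^~ u) f).
Proof.
move=> fR If.
apply: left_ideal_closed => // [|V]; first exact: restrict_power_series.
have [h [Ih hf hV h0]] := separate_weights u V If.
(* The support of [h] lies in that of [f], so [h] is again a power series. *)
exists h; first by split=> // s /fR/h0.
by move=> v vV /=; case: asboolP => [/hf|/(hV v vV)].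
Qed.

Lemma left_span_weight_component f u : power_series f -> I f ->
  left_span (I `&` Z) (restrict (same_weight^~ u) f).
Proof.
move=> fR If; have Ig := ideal_weight_component u fR If.
set g := restrict _ f in Ig *.
(* Multiplication by [x^(-u)] moves the coset of [u] onto the central exponents. *)
have -> : g = monom hq (qweight q u u) u * (monom hq 1 (- u) * g).
  rewrite mulrA monomM subrr mulr1 qweightNr mulfV ?qweight_neq0//.
  exact/esym/mul1r.
apply/left_spanM/left_span_sub; split; first exact: IMl.
apply/centerP => w nw; rewrite lcoef_monom_mul opprK /=.
case: asboolP => [wu|_]; last by rewrite mulr0 mul0r.
by case: nw; rewrite -[w](addrK u); apply: (same_weight_sub _ _).1.
Qed.

Lemma ideal_left_span f : I f -> left_span (I `&` Z) f.
Proof.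
move=> If.
have [m] := laurent_denominator f; set d := monom hq 1 _ => dfR.
have dE : monom hq (qweight q (const_mx m%:Z) (const_mx m%:Z))
    (- const_mx m%:Z) * d = 1.
  by rewrite monomM addNr mulr1 qweightNl mulfV ?qweight_neq0.
rewrite -[f]mul1r -dE -mulrA; apply: left_spanM.
(* From here on [f] stands for the power series [d * f]. *)
move: (d * f) dfR (IMl d If) => {}f {dE d m} fR {}If.
pose cosets (V : seq 'rV[int]_n) : set 'rV[int]_n :=
  [set w | exists2 v, v \in V & same_weight w v].
apply: left_ideal_closed (fR) _ => [||a x|V].
- exact: left_span0.
- by move=> x y; exact: left_spanD.
- exact: left_spanM.
exists (restrict (cosets V) f); last first.
  by move=> v vV /=; rewrite asboolT//; exists v.
split; last exact: restrict_power_series.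
elim: V => [|v V IH].
  suff -> : restrict (cosets [::]) f = 0 by exact: left_span0.
  by apply: laurentP => w /=; rewrite asboolF// => -[].
(* A weight class already met adds nothing; a new one is disjoint from the others, so the
   restrictions add up. *)
have [[v' v'V vv']|nv] := pselect (cosets V v).
  suff -> : cosets (v :: V) = cosets V by [].
  apply/seteqP; split=> w [x]; last first.
    by move=> xV; exists x; rewrite ?inE ?xV ?orbT.
  rewrite inE => /predU1P[-> wv|xV wx]; last by exists x.
  by exists v' => // t; rewrite wv.
suff -> : restrict (cosets (v :: V)) f =
    restrict (same_weight^~ v) f + restrict (cosets V) f.
  by apply: left_spanD => //; apply: left_span_weight_component.
apply: laurentP => w; rewrite lcoefD /=.
have [wv|nwv] := pselect (same_weight w v).
  rewrite asboolT; last by exists v; rewrite ?mem_head.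
  rewrite asboolT// asboolF ?addr0// => -[x xV wx].
  by apply: nv; exists x => // t; rewrite -wv.
rewrite (asboolF nwv) add0r; congr (if `[< _ >] then _ else _).
apply/propext; split=> -[x]; last first.
  by move=> xV; exists x; rewrite ?inE ?xV ?orbT.
by rewrite inE => /predU1P[->//|xV wx]; exists x.
Qed.

Lemma left_span_ideal f : left_span (I `&` Z) f -> I f.
Proof.
move=> [m [a [z [Iz ->]]]]; elim/big_rec: _ => // i x _ Ix.
by apply: ID => //; apply: IMl; case: (Iz i).
Qed.

End Ideal.

(** * Contraction of extended ideals to the center *)

Lemma left_span_center (K : set L) f : is_ideal_of Z K ->
  left_span K f -> Z f -> K f.
Proof.
move=> [KZ K0 KB KM] [m [a [z [Kz fE]]]] /restrict_center <-.
have KD := sub_closedD K0 KB.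
have -> : restrict central_exponent f =
    \sum_(i < m) restrict central_exponent (a i) * z i.
  rewrite fE (_ : restrict _ _ =
      \sum_(i < m) restrict central_exponent (a i * z i)).
    by apply: eq_bigr => i _; apply/restrictM_center/KZ.
  apply: laurentP => u /=; rewrite !lcoef_sum /=.
  by case: asboolP => //; rewrite big1.
elim/big_rec: _ => // i x _ Kx; apply: KD => //.
apply: (KM _ _ _ (Kz i)).1; apply/centerP => u nu /=.
by rewrite asboolF.
Qed.

End Center.

Theorem lemma3p11 (k : fieldType) (n : nat) (q : 'M[k]_n)
    (hn : (0 < n)%N) (hq : multiplicatively_antisymmetric q) :
  (forall I : set (laurent hq), is_ideal_of setT I ->
     I = left_span (I `&` ring_center (laurent hq))) /\
  (forall K : set (laurent hq), is_ideal_of (ring_center (laurent hq)) K ->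
     K = left_span K `&` ring_center (laurent hq)).
Proof.
split=> [I idealI|K idealK]; apply/seteqP; split=> f.
- exact: ideal_left_span.
- exact: left_span_ideal.
- by move=> Kf; split; [apply: left_span_sub|case: idealK => + _ _ _; apply].
- by case; apply: left_span_center.
Qed.
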